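(* Let $\Phi$ be a random dynamical system on a separable Banach space $\mathbb{X}$ over a metric dynamical system $(\Omega,\mathcal{F},P,(\theta_t)_{t\in\mathbb{R}})$, and suppose that $\Phi$ has a random periodic path $Y$ of period $\tau>0$. Let $\mu_s$, $s\in\mathbb{R}$, be the measures on $(\bar\Omega,\bar{\mathcal{F}})=(\Omega\times\mathbb{X},\mathcal{F}\otimes\mathcal{B}(\mathbb{X}))$ given by $\mu_s(A)=\int_\Omega\delta_{Y(s,\omega)}(A_{\theta_s\omega})P(d\omega)$, let $\bar\mu=\frac1\tau\int_0^\tau\mu_s\,ds$, and let $(\bar\Theta_t)_{t\ge0}$ be the skew product. If the metric dynamical system $(\Omega,\mathcal{F},P,(\theta_\tau^n)_{n\ge0})$ is ergodic, then the skew product dynamical system $(\bar\Omega,\bar{\mathcal{F}},\mu_s,(\bar\Theta_\tau^n)_{n\ge0})$ is ergodic for each $s\in\mathbb{R}$, and $(\bar\Omega,\bar{\mathcal{F}},\bar\mu,(\bar\Theta_t)_{t\ge0})$ is ergodic.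
   Context: Metric dynamical system: a probability space $(\Omega,\mathcal{F},P)$ with a $(\mathcal{B}(\mathbb{R})\otimes\mathcal{F},\mathcal{F})$-measurable map $\theta:\mathbb{R}\times\Omega\to\Omega$ such that $\theta_t\circ\theta_s=\theta_{t+s}$ and $\theta_tP=P$ for all $s,t\in\mathbb{R}$ (with $\theta_0=\mathrm{id}$). Random dynamical system: a measurable map $\Phi:\mathbb{R}^+\times\Omega\times\mathbb{X}\to\mathbb{X}$ such that, almost surely, $\Phi(0,\omega)=\mathrm{id}$ and $\Phi(t+s,\omega)=\Phi(t,\theta_s\omega)\circ\Phi(s,\omega)$ for all $t,s\ge0$. Random periodic path of period $\tau$: a $(\mathcal{B}(\mathbb{R})\otimes\mathcal{F},\mathcal{B}(\mathbb{X}))$-measurable map $Y:\mathbb{R}\times\Omega\to\mathbb{X}$ such that for almost all $\omega$, $\Phi(t,\theta_s\omega)Y(s,\omega)=Y(t+s,\omega)$ and $Y(s+\tau,\omega)=Y(s,\theta_\tau\omega)$ for all $t\ge0$, $s\in\mathbb{R}$. Skew product: $\bar\Theta_t(\omega,x)=(\theta_t\omega,\Phi(t,\omega)x)$, $t\ge 0$. $A_\omega=\{x:(\omega,x)\in A\}$ denotes the $\omega$-section of $A$. Equivalently $\mu_s(A)=P(\{\omega:(\omega,Y(s,\theta_{-s}\omega))\in A\})$. It is known that $\mu_{s+\tau}=\mu_s$ and $\bar\Theta_t\mu_s=\mu_{t+s}$ for all $t\ge0,s\in\mathbb{R}$, and that $\bar\mu$ is $\bar\Theta_t$-invariant. A measure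 preserving dynamical system is ergodic if every invariant measurable set (i.e. $\bar\Theta_\tau^{-1}A=A$, resp. $\bar\Theta_t^{-1}A=A$ for all $t\ge0$, resp. $\theta_\tau^{-1}A=A$) has measure $0$ or $1$. *)

(* Defs.v *)
From HB Require Import structures.
From mathcomp Require Import all_boot all_order all_algebra.
From mathcomp Require Import all_classical all_reals all_analysis.
From mathcomp Require Import measurable_realfun.

Set Implicit Arguments.
Unset Strict Implicit.
Unset Printing Implicit Defensive.

Import Order.TTheory GRing.Theory Num.Theory.
Import numFieldNormedType.Exports.

Local Open Scope classical_set_scope.
Local Open Scope ring_scope.

Definition separable (X : topologicalType) : Prop :=
  exists2 S : set X, countable S & dense S.

Notation borel X := (g_sigma_algebraType (@open X)).

Section ergodicity.
Context d (T : measurableType d) (R : realType) (m : probability T R).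

Definition measure_preserving (f : T -> T) : Prop :=
  measurable_fun setT f /\ forall A, measurable A -> m (f @^-1` A) = m A.

(* the system (T, m, (f^n)_{n >= 0}) *)
Definition ergodic_map (f : T -> T) : Prop :=
  measure_preserving f /\
  forall A, measurable A -> f @^-1` A = A -> m A = 0%E \/ m A = 1%E.

(* the system (T, m, (f_t)_{t >= 0}); f t is irrelevant for t < 0 *)
Definition ergodic_semiflow (f : R -> T -> T) : Prop :=
  (forall t, 0 <= t -> measure_preserving (f t)) /\
  forall A, measurable A -> (forall t, 0 <= t -> f t @^-1` A = A) ->
    m A = 0%E \/ m A = 1%E.

End ergodicity.

Record metric_ds d (Omega : measurableType d) (R : realType)
    (P : probability Omega R) := MetricDS {
  mds_flow :> R -> Omega -> Omega ;
  mds_measurable : measurable_fun [set: R * Omega]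
    (fun p : R * Omega => mds_flow p.1 p.2) ;
  mds_flow0 : forall w, mds_flow 0 w = w ;
  mds_flowD : forall s t w, mds_flow t (mds_flow s w) = mds_flow (t + s) w ;
  mds_preserving : forall t, measure_preserving P (mds_flow t) }.

(* Time ranges over R, but only times t >= 0 are constrained (and used). *)
Record random_ds d (Omega : measurableType d) (R : realType)
    (P : probability Omega R) (theta : metric_ds P)
    (X : completeNormedModType R) := RandomDS {
  rds_map :> R -> Omega -> X -> X ;
  rds_measurable : measurable_fun
    [set p : R * Omega * borel X | 0 <= p.1.1]
    (fun p : R * Omega * borel X => rds_map p.1.1 p.1.2 p.2 : borel X) ;
  rds_cocycle : {ae P, forall w,
    (forall x, rds_map 0 w x = x) /\
    (forall t s, 0 <= t -> 0 <= s -> forall x,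
       rds_map (t + s) w x = rds_map t (theta s w) (rds_map s w x))} }.

Record random_periodic_path d (Omega : measurableType d) (R : realType)
    (P : probability Omega R) (theta : metric_ds P)
    (X : completeNormedModType R) (Phi : random_ds theta X) (tau : R) :=
  RandomPeriodicPath {
  rpp_map :> R -> Omega -> X ;
  rpp_measurable : measurable_fun [set: R * Omega]
    (fun p : R * Omega => rpp_map p.1 p.2 : borel X) ;
  rpp_periodic : {ae P, forall w,
    (forall t s, 0 <= t -> Phi t (theta s w) (rpp_map s w) = rpp_map (t + s) w)
    /\ (forall s, rpp_map (s + tau) w = rpp_map s (theta tau w))} }.

Definition skew_product d (Omega : measurableType d) (R : realType)
    (P : probability Omega R) (theta : metric_ds P)
    (X : completeNormedModType R) (Phi : random_ds theta X) (t : R)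
    (z : Omega * borel X) : Omega * borel X :=
  (theta t z.1, Phi t z.1 z.2).

Section periodic_measures.
Context d (Omega : measurableType d) (R : realType) (P : probability Omega R).
Context (theta : metric_ds P) (X : completeNormedModType R).
Context (Phi : random_ds theta X) (tau : R).
Variable Y : random_periodic_path Phi tau.

Local Open Scope ereal_scope.

Definition mu_ (s : R) (A : set (Omega * borel X)) : \bar R :=
  \int[P]_w \d_(Y s w : borel X) (xsection A (theta s w)).

Let joint (p : R * Omega) : Omega * borel X := (theta p.1 p.2, Y p.1 p.2).

Let measurable_joint : measurable_fun setT joint.
Proof.
apply/measurable_fun_pairP; split; [exact: mds_measurable|exact: rpp_measurable].
Qed.

Let measurable_joint_s s : measurable_fun setT (fun w => joint (s, w)).
Proof. by apply: measurableT_comp => //; exact: measurable_joint. Qed.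

Let dirac_joint s w (A : set (Omega * borel X)) :
  \d_(Y s w : borel X) (xsection A (theta s w)) =
  \d_(joint (s, w)) A :> \bar R.
Proof.
rewrite !diracE; congr (_%:R%:E); congr nat_of_bool.
by apply/idP/idP; rewrite !inE /xsection /= !inE.
Qed.

Lemma mu_E s A : measurable A ->
  mu_ s A = P [set w | A (theta s w, Y s w)].
Proof.
move=> mA; rewrite -[RHS]/(P ((fun w => joint (s, w)) @^-1` A)).
rewrite -[RHS]/(pushforward P (fun w => joint (s, w)) A).
rewrite /mu_ /pushforward -[in RHS](setIT (_ @^-1` _)) -integral_indic//.
  by apply: eq_integral => w _; rewrite dirac_joint diracE indicE.
by rewrite -[X in measurable X]setTI; exact: measurable_joint_s.
Qed.

Let mu_0 s : mu_ s set0 = 0.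
Proof. by rewrite mu_E// measure0. Qed.

Let mu_ge0 s A : 0 <= mu_ s A.
Proof. by apply: integral_ge0 => w _; exact: measure_ge0. Qed.

Let mu_sigma_additive s : semi_sigma_additive (mu_ s).
Proof.
move=> F mF tF mUF; rewrite mu_E//.
rewrite (_ : (fun n => _) =
    (fun n => \sum_(0 <= i < n) P ((fun w => joint (s, w)) @^-1` F i))).
  have -> : [set w | (\bigcup_n F n) (theta s w, Y s w)] =
      \bigcup_n ((fun w => joint (s, w)) @^-1` F n) by [].
  apply: measure_semi_sigma_additive.
  - by move=> i; rewrite -[X in measurable X]setTI; exact: measurable_joint_s.
  - apply/trivIsetP => i j _ _ ij; rewrite -preimage_setI.
    by move/trivIsetP : tF => ->//; rewrite preimage_set0.
  - rewrite -preimage_bigcup -[X in measurable X]setTI.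
    exact: measurable_joint_s.
by apply/funext => n; apply: eq_bigr => i _; rewrite mu_E.
Qed.

HB.instance Definition _ s := isMeasure.Build _ _ _ (mu_ s)
  (mu_0 s) (mu_ge0 s) (@mu_sigma_additive s).

Let mu_setT s : mu_ s setT = 1.
Proof. by rewrite mu_E// -[RHS](probability_setT P). Qed.

HB.instance Definition _ s := Measure_isProbability.Build _ _ _ (mu_ s)
  (mu_setT s).

Lemma measurable_mu_ A : measurable A ->
  measurable_fun [set: R] (fun s : R => mu_ s A).
Proof.
move=> mA.
have -> : (fun s => mu_ s A) = (fun s => \int[P]_w \d_(joint (s, w)) A).
  by apply/funext => s; apply: eq_integral => w _; rewrite dirac_joint.
apply: (measurable_fun_fubini_tonelli_F (fun p => \d_(joint p) A)) => //.
apply: (measurableT_comp (measurable_fun_dirac mA)).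
exact: measurable_joint.
Qed.

Variable tau0 : (0 < tau)%R.

(* The proof of 0 < tau does not occur in the formula; it is an argument so
   that mubar can be equipped with a structure of probability measure. *)
Definition mubar of (0 < tau)%R := fun A : set (Omega * borel X) =>
  (tau^-1)%:E * \int[lebesgue_measure]_(s in `[0%R, tau]) mu_ s A.

Let mubar_0 : mubar tau0 set0 = 0.
Proof.
by rewrite /mubar integral0_eq ?mule0// => s _; rewrite measure0.
Qed.

Let mubar_ge0 A : 0 <= mubar tau0 A.
Proof.
apply: mule_ge0; first by rewrite lee_fin invr_ge0 ltW.
by apply: integral_ge0 => s _; exact: measure_ge0.
Qed.

Let mubar_sigma_additive : semi_sigma_additive (mubar tau0).
Proof.
move=> F mF tF mUF.
have -> : mubar tau0 (\bigcup_n F n) = \sum_(0 <= i <oo) mubar tau0 (F i).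
  rewrite nneseriesZl//; last first.
    by move=> i _; apply: integral_ge0 => s _; exact: measure_ge0.
  congr (_ * _).
  rewrite -integral_nneseries//.
  - by apply: eq_integral => s _; exact: measure_semi_bigcup.
  - by move=> n; apply: measurable_funTS; exact: measurable_mu_.
apply: is_cvg_nneseries => n _ _; exact: mubar_ge0.
Qed.

HB.instance Definition _ := isMeasure.Build _ _ _ (mubar tau0)
  mubar_0 mubar_ge0 mubar_sigma_additive.

Let mubar_setT : mubar tau0 setT = 1.
Proof.
rewrite /mubar (eq_integral (cst 1)); last by move=> s _; exact: mu_setT.
rewrite integral_cst// mul1e /= lebesgue_measure_itv/= lte_fin tau0 -EFinB subr0.
by rewrite -EFinM mulVf// gt_eqF.
Qed.

HB.instance Definition _ := Measure_isProbability.Build _ _ _ (mubar tau0)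
  mubar_setT.

End periodic_measures.

(* Main.v *)
(* The measure mu_s is the image of P under J_s w = (theta_s w, Y(s, w)).
   Almost surely Theta_t (J_s w) = J_(t+s) w and J_(s+tau) = J_s o theta_tau, so
   J_s intertwines theta_tau and Theta_tau almost surely: the preimage under J_s
   of a Theta_tau-invariant set is theta_tau-invariant up to a null set, hence
   P-trivial. If A is invariant under every Theta_t, then
   mu_s(A) = mu_0(Theta_s^-1 A) = mu_0(A) for s >= 0, so averaging over a period
   gives mubar(A) = mu_0(A), which is 0 or 1. *)
Require Import Defs.
From mathcomp Require Import all_boot all_order all_algebra.
From mathcomp Require Import all_classical all_reals all_analysis.
From mathcomp Require Import measurable_realfun.
Import Order.TTheory GRing.Theory Num.Theory.
Import numFieldNormedType.Exports.
Local Open Scope ring_scope.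

(** * Null sets and almost surely invariant sets *)

Section ae_sets.
Local Open Scope classical_set_scope.
Context {d} {T : measurableType d} {R : realType}.

Lemma ae_eq_measure (m : {measure set T -> \bar R}) (A B : set T) :
  measurable A -> measurable B -> {ae m, forall x, A x <-> B x} -> m A = m B.
Proof.
move=> mA mB [N [mN N0 ABN]].
rewrite -(@measureU0 _ _ _ m A N)// -(@measureU0 _ _ _ m B N)//.
congr (m _); apply/seteqP; split => x [Cx|Nx]; try by right.
  have [Nx|/contra_notP AB] := pselect (N x); first by right.
  by left; apply/(AB _ (ABN x)).
have [Nx|/contra_notP AB] := pselect (N x); first by right.
by left; apply/(AB _ (ABN x)).
Qed.

Variable m : probability T R.

Lemma measurable_preserving (f : T -> T) (A : set T) :
  measure_preserving m f -> measurable A -> measurable (f @^-1` A).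
Proof. by move=> [mf _] mA; rewrite -[X in measurable X]setTI; exact: mf. Qed.

Lemma ae_preserving (f : T -> T) (Q : set T) : measure_preserving m f ->
  {ae m, forall x, Q x} -> {ae m, forall x, Q (f x)}.
Proof.
move=> mpf [N [mN N0 QN]]; exists (f @^-1` N); split.
- exact: measurable_preserving.
- by rewrite (mpf.2 _ mN).
- by move=> x; exact: QN.
Qed.

(* The limsup of the iterated preimages of B is strictly invariant and differs
   from B by a null set. *)
Lemma ergodic_ae_invariant (f : T -> T) (B : set T) : ergodic_map m f ->
  measurable B -> {ae m, forall x, B (f x) <-> B x} -> m B = 0%E \/ m B = 1%E.
Proof.
move=> [mpf erg] mB fB.
have mF n : measurable (iter n f @^-1` B).
  elim: n => // n ih; rewrite [X in measurable X](_ : _ =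
    f @^-1` (iter n f @^-1` B)); first exact: measurable_preserving.
  by apply/seteqP; split => x /=; rewrite -iterS iterSr.
pose B' := lim_sup_set (fun n => iter n f @^-1` B).
have mB' : measurable B'.
  by apply: bigcap_measurable => // n _; exact: bigcup_measurable.
have aeB n : {ae m, forall x, B (iter n f x) <-> B x}.
  elim: n => [|n ih]; first exact: aeW.
  have := ae_preserving _ _ mpf ih.
  by apply: filterS2 fB => x fBx /=; rewrite -iterSr => ->.
have -> : m B = m B'.
  apply: ae_eq_measure => //.
  (* Countably many null sets have a null union, so almost surely all iterates of [x] are in [B] or
     none is, according to whether [x] is. Membership in the limsup is then membership in [B]. *)
  have : {ae m, forall x, forall n, B (iter n f x) <-> B x}.
    exact: ae_foralln.
  apply: filterS => x Bx; split => [xB n _|/(_ 0%N I)[n _ /Bx]//].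
  by exists n => //=; exact/Bx.
apply: erg => //; apply/seteqP; split => x /= B'x n _.
  have [k /= nk] := B'x n I; rewrite -iterSr => Bk.
  by exists k.+1 => //=; exact: leqW.
(* Asking for a visit at an index at least [n.+1] excludes index 0 and leaves a predecessor
   [k >= n], which is the time of the same visit counted from [f x]. *)
have [[//|k] /= nk] := B'x n.+1 I; rewrite -/(iter k.+1 f x) iterSr => Bk.
by exists k.
Qed.

End ae_sets.

(** * Translation of Lebesgue integrals and periodic integrands *)

Section lebesgue_translation.
Local Open Scope classical_set_scope.
Local Open Scope ereal_scope.
Context {R : realType}.
Notation mu := (@lebesgue_measure R).

Let measurable_shift (t : R) :
  measurable_fun setT ((fun x => x + t)%R : measurableTypeR R -> measurableTypeR R).
Proof. by apply: measurable_funD. Qed.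

Lemma shift_preimage_itv (t a b : R) (x y : bool) :
  (fun z => z + t)%R @^-1` [set` Interval (BSide x a) (BSide y b)] =
  [set` Interval (BSide x (a - t)%R) (BSide y (b - t)%R)].
Proof.
apply/seteqP; split => z /=; rewrite !in_itv/= !lteifBlDr !lteifBrDr//.
Qed.

(** Lebesgue measure is determined by its values on half-open intervals, and a translation keeps
    their length. *)
Lemma lebesgue_measure_shift (t : R) (A : set R) : measurable A ->
  pushforward mu ((fun x => x + t)%R : measurableTypeR R -> measurableTypeR R) A
  = mu A.
Proof.
move=> mA; apply/esym/lebesgue_measure_unique => //= _ [[a b]] _ <-.
rewrite /pushforward shift_preimage_itv/= !lebesgue_measure_itv/=.
by rewrite !lte_fin ltrD2r -!EFinB opprB addrA subrK.
Qed.

Lemma ge0_integral_shift (f : R -> \bar R) (t : R) (D : set R) :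
  measurable D -> measurable_fun D f -> (forall x, 0 <= f x) ->
  \int[mu]_(x in (fun z => z + t)%R @^-1` D) f (x + t)%R = \int[mu]_(x in D) f x.
Proof.
move=> mD mf f0.
rewrite -(@ge0_integral_pushforward _ _ _ _ _ _ (measurable_shift t) mu D f)//.
by apply: eq_measure_integral => A mA _; exact: lebesgue_measure_shift.
Qed.

(** This gives the invariance of [mubar], where the skew product shifts the time [s] of [mu_ Y s]. A
    shift by at most one period is handled by cutting and moving a piece of the window; larger
    shifts are reduced by whole periods. *)
Lemma ge0_integral_periodic (f : R -> \bar R) (p t : R) : (0 < p)%R ->
  measurable_fun setT f -> (forall x, 0 <= f x) ->
  (forall x, f (x + p)%R = f x) -> (0 <= t)%R ->
  \int[mu]_(x in `[0%R, p]) f (x + t)%R = \int[mu]_(x in `[0%R, p]) f x.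
Proof.
move=> p0 mf f0 fp t0.
have mfD (D : set R) : measurable_fun D f by exact: measurable_funTS.
have mft (u : R) : measurable_fun setT (fun x : R => f (x + u)%R).
  exact: (measurableT_comp mf (measurable_shift u)).
(* Half-open intervals make adjacent pieces disjoint; the dropped endpoint is a null set. *)
have ico (u : R) (a b : R) :
    \int[mu]_(x in `[a, b]) f (x + u)%R = \int[mu]_(x in `[a, b[) f (x + u)%R.
  rewrite -integral_itv_bndo_bndc//.
  by apply: measurable_funTS; exact: mft.
have ico0 : \int[mu]_(x in `[0%R, p]) f x = \int[mu]_(x in `[0%R, p[) f x.
  by rewrite -integral_itv_bndo_bndc.
have split_itv (a b c : R) : (a <= b)%R -> (b <= c)%R ->
    \int[mu]_(x in `[a, c[) f x =
    \int[mu]_(x in `[a, b[) f x + \int[mu]_(x in `[b, c[) f x.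
  move=> ab bc; rewrite -ge0_integral_setU//=.
    by rewrite -itv_bndbnd_setU// bnd_simp.
    exact: mfD.
  apply/disj_set2P/seteqP; split => // x [] /=.
  by rewrite !in_itv/= => /andP[_ xb] /andP[/(lt_le_trans xb)]; rewrite ltxx.
have shift (u a b : R) : \int[mu]_(x in `[(a - u)%R, (b - u)%R[) f (x + u)%R =
    \int[mu]_(x in `[a, b[) f x.
  by rewrite -(@ge0_integral_shift f u `[a, b[)// shift_preimage_itv.
have small u : (0 <= u)%R -> (u <= p)%R ->
    \int[mu]_(x in `[0%R, p]) f (x + u)%R = \int[mu]_(x in `[0%R, p]) f x.
  move=> u0 up; rewrite ico ico0.
  have := shift u u (p + u)%R; rewrite subrr addrK => ->.
  (* The window [[u, p + u[] is cut at [p] and [[0, p[] at [u]. They share [[u, p[], and [[p, p +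
     u[] is [[0, u[] moved by one period. *)
  rewrite (split_itv u p)// ?lerDl// (split_itv 0%R u p)// addeC; congr (_ + _).
  have := shift p p (p + u)%R; rewrite subrr addrAC subrr add0r => <-.
  exact: eq_integral.
have [n] : exists n, (t <= n%:R * p)%R.
  exists (Num.trunc (t / p)).+1; rewrite -ler_pdivrMr//.
  exact/ltW/truncnS_gt.
(* [n] bounds the number of periods in [t]; each step with [t > p] replaces [t] by [t - p]. *)
elim: n t t0 => [|n ih] t t0 tn.
  by apply: small => //; rewrite (le_trans tn)// mul0r ltW.
have [/small->//|/ltW pt] := leP t p.
rewrite -(ih (t - p)%R) ?subr_ge0//.
  by apply: eq_integral => x _; rewrite -[in LHS](subrK p t) addrA fp.
by rewrite lerBlDr (le_trans tn)// -natr1 mulrDl mul1r.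
Qed.

End lebesgue_translation.

(** * The skew product acting on the measures of the periodic path *)

Section random_periodic_path.
Local Open Scope classical_set_scope.
Context {R : realType} {d : measure_display} {Omega : measurableType d}.
Context {P : probability Omega R} {theta : metric_ds P}.
Context {X : completeNormedModType R} {Phi : random_ds theta X} {tau : R}.
Variable Y : random_periodic_path Phi tau.
Implicit Types A : set (Omega * borel X).

(** This is the map [J_s], which carries [P] to [mu_ Y s]. *)
Let joint (s : R) (w : Omega) : Omega * borel X := (theta s w, Y s w).

Let measurable_joint s : measurable_fun setT (joint s).
Proof.
apply/measurable_fun_pairP; split; first exact: (mds_preserving theta s).1.
exact: (measurableT_comp (rpp_measurable Y) (measurable_pair1 s)).
Qed.

Let measurable_joint_preimage s A :
  measurable A -> measurable (joint s @^-1` A).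
Proof.
by move=> mA; rewrite -[X in measurable X]setTI; exact: measurable_joint.
Qed.

Let mu_joint s A : measurable A -> mu_ Y s A = P (joint s @^-1` A).
Proof. exact: mu_E. Qed.

Let skew_product_joint (t : R) : 0 <= t -> forall s,
  {ae P, forall w, skew_product Phi t (joint s w) = joint (t + s) w}.
Proof.
move=> t0 s; apply: filterS (rpp_periodic Y) => w [+ _].
by move=> /(_ t s t0) YE; rewrite /skew_product /joint/= YE mds_flowD.
Qed.

Let joint_periodic s :
  {ae P, forall w, joint (s + tau) w = joint s (theta tau w)}.
Proof.
apply: filterS (rpp_periodic Y) => w [_ YE].
by rewrite /joint YE mds_flowD.
Qed.

Lemma measurable_skew_product (t : R) : 0 <= t ->
  measurable_fun setT (skew_product Phi t).
Proof.
move=> t0; apply/measurable_fun_pairP; split.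
  exact: (measurableT_comp (mds_preserving theta t).1 measurable_fst).
pose g (z : Omega * borel X) : R * Omega * borel X := (t, z.1, z.2).
have mg : measurable_fun setT g.
  apply: measurable_fun_pair measurable_snd.
  exact: measurable_fun_pair (measurable_cst _) measurable_fst.
(* [Phi] is known to be measurable only on nonnegative times, so that domain must be shown
   measurable and must contain the range of [g]. *)
apply: (measurable_comp _ _ (rds_measurable Phi) mg).
- have -> : [set p : R * Omega * borel X | 0 <= p.1.1] =
    setT `&` (fst \o fst) @^-1` `[0, +oo[.
    by apply/seteqP; split => p /=; rewrite in_itv/= andbT// => -[].
  have : measurable_fun [set: R * Omega * borel X] (fst \o fst).
    exact: measurableT_comp measurable_fst measurable_fst.
  exact.
- by move=> _ [z _ <-].
Qed.

Let measurable_skew_preimage (t : R) A : 0 <= t -> measurable A ->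
  measurable (skew_product Phi t @^-1` A).
Proof.
move=> t0 mA; rewrite -[X in measurable X]setTI.
exact: measurable_skew_product.
Qed.

Lemma mu_skew_product (t s : R) A : 0 <= t -> measurable A ->
  mu_ Y s (skew_product Phi t @^-1` A) = mu_ Y (t + s) A.
Proof.
move=> t0 mA; rewrite !mu_joint//; last exact: measurable_skew_preimage.
apply: ae_eq_measure; [|exact: measurable_joint_preimage|].
  by apply: measurable_joint_preimage; exact: measurable_skew_preimage.
by apply: filterS (skew_product_joint _ t0 s) => w /= ->.
Qed.

(** Almost surely [J_(s + tau)] is [J_s] after [theta tau], and [theta tau] preserves [P]. *)
Lemma mu_periodic (s : R) A : measurable A -> mu_ Y (s + tau) A = mu_ Y s A.
Proof.
move=> mA; rewrite !mu_joint//.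
rewrite -((mds_preserving theta tau).2 (joint s @^-1` A)); last first.
  exact: measurable_joint_preimage.
apply: ae_eq_measure; [exact: measurable_joint_preimage| |].
  apply: (measurable_preserving _ _ _ (mds_preserving theta tau)).
  exact: measurable_joint_preimage.
by apply: filterS (joint_periodic s) => w /= ->.
Qed.

Hypothesis tau0 : 0 < tau.
Hypothesis ergP : ergodic_map P (theta tau).

Lemma mu_ergodic s : ergodic_map (mu_ Y s) (skew_product Phi tau).
Proof.
split.
  split; first exact: measurable_skew_product (ltW tau0).
  move=> A mA; rewrite -[RHS]mu_periodic// addrC.
  exact: mu_skew_product (ltW tau0) mA.
move=> A mA invA; rewrite /= mu_joint//.
apply: (ergodic_ae_invariant _ _ _ ergP).
  exact: measurable_joint_preimage.
(* Almost surely [joint s (theta tau w)] is the image of [joint s w] under the skew product at time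
   [tau], so invariance of [A] makes its preimage under [joint s] almost surely invariant under
   [theta tau]. *)
apply: filterS2 (joint_periodic s) (skew_product_joint _ (ltW tau0) s) => w /=.
by rewrite addrC => <- <-; rewrite -[in X in _ <-> X]invA.
Qed.

Lemma mubar_ergodic : ergodic_semiflow (mubar Y tau0) (skew_product Phi).
Proof.
split=> [t t0|A mA invA].
  split; first exact: measurable_skew_product.
  move=> A mA; rewrite /= /mubar; congr (_ * _)%E.
  (* Pulling [A] back by time [t] turns the integrand into [mu_ Y (s + t) A]; a shift of a
     [tau]-periodic function leaves its integral over one period unchanged. *)
  rewrite -[RHS](@ge0_integral_periodic _ _ _ t)//.
  - by apply: eq_integral => s _; rewrite mu_skew_product// addrC.
  - exact: measurable_mu_.
  - by move=> s; exact: mu_periodic.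
rewrite /=; have -> : mubar Y tau0 A = mu_ Y 0 A.
  rewrite /mubar (eq_integral (cst (mu_ Y 0 A))).
    rewrite integral_cst//= lebesgue_measure_itv/= lte_fin tau0 -EFinB subr0.
    by rewrite muleC -muleA -EFinM mulfV ?mule1// gt_eqF.
  move=> s; rewrite inE/= in_itv/= => /andP[s0 _].
  by rewrite -[in LHS](addr0 s) -mu_skew_product// invA.
apply: (mu_ergodic 0).2 => //.
exact/invA/ltW.
Qed.

End random_periodic_path.

Theorem theorem2p10 (R : realType) (d : measure_display)
    (Omega : measurableType d) (P : probability Omega R)
    (theta : metric_ds P)
    (X : completeNormedModType R) (sepX : separable X)
    (Phi : random_ds theta X)
    (tau : R) (tau0 : 0 < tau) (Y : random_periodic_path Phi tau) :
  ergodic_map P (theta tau) ->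
  (forall s : R, ergodic_map (mu_ Y s) (skew_product Phi tau)) /\
  ergodic_semiflow (mubar Y tau0) (skew_product Phi).
Proof.
move=> ergP; split=> [s|]; first exact: mu_ergodic.
exact: mubar_ergodic.
Qed.
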